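(* Let $\Omega_x\subset\mathbb{R}$ be an open interval and let $\bar H_{r-1}=(B\cdot\Psi_{r-1})\circ(A\cdot\Phi_{r-1})^{-1}$ be a transported subspace whose functions $\psi_i\in\Psi_{r-1}$ have the form $$\psi_i(x)=\sum_{j=1}^{N_i}c_{ij}\,\rho(x-x_{ij}),\qquad i=1,\dots,r-1,$$ with $A\subset\mathbb{R}^{r-1}$ admissible for $\Phi_{r-1}$ on $\Omega_x$ and $B\subset\mathbb{R}^{r-1}$ bounded, and let $\varepsilon>0$. Then there exist a LRNR $H_r$ of rank $r$, depth $L=2$, degrees of freedom $K\lesssim\sum_i N_i$ and width $M\sim K$, coefficient sets $C,D$, and an affine map $\mu:A\times B\to C\times D$, $\mu(\alpha,\beta)=(\gamma,\theta)$, such that for all $(\alpha,\beta)\in A\times B$, $$\|\bar h(\alpha,\beta)-h(\gamma,\theta)\|_{L^1(\Omega_x)}\le\Big(\sum_i|\psi_i|_{TV(\widehat\Omega_x)}\Big)\Big(\sup_{\beta\in B}\|\beta\|_\infty\Big)\|\rho-\rho_\varepsilon\|_{L^1(\mathbb{R})}.$$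
   Context: $\rho:=\mathbf 1_{[0,\infty)}$; $\sigma(x)=\max\{0,x\}$; $\rho_\varepsilon(x):=\frac1\varepsilon[\sigma(x+\frac\varepsilon2)-\sigma(x-\frac\varepsilon2)]$. $P_0$, $P_1$ denote piecewise constant and piecewise linear functions. For $\Phi_r=(\phi_i)_{i=1}^r$ and $A\subset\mathbb{R}^r$, $A\cdot\Phi_r:=\{\sum_i\alpha_i\phi_i\mid\alpha\in A\}$. Admissible coefficients: given $\Phi_r\subset P_1(\mathbb{R})\cap C(\mathbb{R})$, $A\subset\mathbb{R}^r$ is admissible for $\Phi_r$ on $\Omega_x$ if there are constants $c_A,C_A>0$ with $c_A\le g'\le C_A$ for all $g\in A\cdot\Phi_r$, and $g(\mathbb{R})\supset\Omega_x$ for all $g\in A\cdot\Phi_r$; then $\widehat\Omega_x:=\bigcup_{g\in A\cdot\Phi_r}g^{-1}(\Omega_x)$. Transported subspace: for linearly independent $\Phi_r\subset P_1(\mathbb{R})\cap C(\mathbb{R})$, $\Psi_r\subset P_0(\mathbb{R})\cap BV(\mathbb{R})$, $A$ admissible and $B$ bounded, $\bar H_r:=\{f\circ g^{-1}|_{\Omega_x}: f\in B\cdot\Psi_r,\ g\in A\cdot\Phi_r\}$, and $\bar h(\alpha,\beta):=(\sum_i\beta_i\psi_i)\circ(\sum_i\alpha_i\phi_i)^{-1}$. LRNR (low rank neural representation): fix depth $L$ and widths $M_0=1,M_1,\dots,M_{L-1},M_L=1$, width $M=\max_\ell M_\ell$. A feedforward network is $h(x;W,B)=A^L\circ\sigma\odot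 A^{L-1}\circ\cdots\circ\sigma\odot A^1(x)$ with $A^\ell(z)=W^\ell z+B^\ell$, $W^\ell\in\mathbb{R}^{M_\ell\times M_{\ell-1}}$, $B^\ell\in\mathbb{R}^{M_\ell}$, $\sigma$ applied entrywise. A LRNR of rank $r$ is given by fixed $U_1^\ell,\dots,U_r^\ell$ (weight-shaped) and $V_1^\ell,\dots,V_r^\ell$ (bias-shaped) for each layer $\ell$, each a product $a\bullet b$ of two vectors with $\bullet\in\{\otimes,\otimes_d,{}_d\otimes\}$, where $\otimes$ is the Kronecker product, $a\otimes_d b:=a\otimes\mathrm{diag}(b)$, $a\,{}_d\!\otimes b:=\mathrm{diag}(a)\otimes b$; and coefficient sets $C=\prod_\ell C^\ell$, $D=\prod_\ell D^\ell$ with $C^\ell,D^\ell\subset\mathbb{R}^r$. Its members are $h(\gamma,\theta):=h(\cdot;W,B)$ with $W^\ell=\sum_{i=1}^r\gamma_i^\ell U_i^\ell$, $B^\ell=\sum_{i=1}^r\theta_i^\ell V_i^\ell$, $(\gamma,\theta)\in C\times D$. The degrees of freedom $K$ is the number of stored (unconstrained) real parameters defining the $U_i^\ell,V_i^\ell$. *)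

(* Defs.v *)
From HB Require Import structures.
From mathcomp Require Import all_boot all_order all_algebra.
From mathcomp Require Import all_classical all_reals all_analysis.
Set Implicit Arguments. Unset Strict Implicit. Unset Printing Implicit Defensive.
Import Order.TTheory GRing.Theory Num.Theory.
Import numFieldNormedType.Exports.
Local Open Scope classical_set_scope.
Local Open Scope ring_scope.

Section LRNRDefs.
Variable R : realType.

Definition rho (x : R) : R := if 0 <= x then 1 else 0.
Definition relu (x : R) : R := Num.max 0 x.
Definition rho_eps (eps x : R) : R :=
  eps^-1 * (relu (x + eps / 2) - relu (x - eps / 2)).

Definition psi_of (s : seq (R * R)) (x : R) : R :=
  \sum_(p <- s) p.1 * rho (x - p.2).

Definition lincomb n (a : 'rV[R]_n) (f : 'I_n -> R -> R) (x : R) : R :=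
  \sum_(i < n) a 0 i * f i x.

Definition pw_linear (f : R -> R) : Prop :=
  exists s : seq R, forall x y, x < y ->
    (forall z, z \in s -> ~ (x < z /\ z < y)) ->
    exists a b : R, forall t, x < t -> t < y -> f t = a * t + b.

Definition P1C (f : R -> R) : Prop := pw_linear f /\ continuous f.

Definition lin_indep n (f : 'I_n -> R -> R) : Prop :=
  forall a : 'rV[R]_n, (forall x, lincomb a f x = 0) -> a = 0.

Definition admissible n (phi : 'I_n -> R -> R) (A : set 'rV[R]_n) (Om : set R) :=
  exists cA CA : R, 0 < cA /\ 0 < CA /\
    forall a, A a ->
      (forall x, derivable (lincomb a phi) x 1 ->
         cA <= derive1 (lincomb a phi) x <= CA) /\
      Om `<=` range (lincomb a phi).

Definition Om_hat n (phi : 'I_n -> R -> R) (A : set 'rV[R]_n) (Om : set R) : set R :=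
  \bigcup_(a in A) (lincomb a phi @^-1` Om).

Definition coef_bounded n (B : set 'rV[R]_n) : Prop :=
  exists M : R, forall b, B b -> forall i, `|b 0 i| <= M.

Definition supnorm n (b : 'rV[R]_n) : R := \big[Num.max/0]_(i < n) `|b 0 i|.

Definition TV (U : set R) (f : R -> R) : \bar R :=
  ereal_sup [set (\sum_(k < (size s).-1) `|f (nth 0 s k.+1) - f (nth 0 s k)| )%:E
            | s in [set s : seq R | sorted <%R s /\
                 forall k, (k.+1 < size s)%N ->
                   [set t | nth 0 s k <= t <= nth 0 s k.+1] `<=` U]].

(* inverse of g (chosen by xget; unique for strictly increasing surjective g) *)
Definition ginv (g : R -> R) (x : R) : R := xget 0 [set t | g t = x].

Definition hbar n (phi : 'I_n -> R -> R) (ps : 'I_n -> seq (R * R))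
  (a b : 'rV[R]_n) (x : R) : R :=
  lincomb b (fun i => psi_of (ps i)) (ginv (lincomb a phi) x).

Inductive vform := VCol | VRow | VDiag.
Definition is_vec (f : vform) : bool := if f is VDiag then false else true.

Definition vdims (f : vform) (p : nat) : nat * nat :=
  match f with VCol => (p, 1%N) | VRow => (1%N, p) | VDiag => (p, p) end.

Definition ventry (f : vform) (a : seq R) (i j : nat) : R :=
  match f with
  | VCol => if j == 0%N then nth 0 a i else 0
  | VRow => if i == 0%N then nth 0 a j else 0
  | VDiag => if i == j then nth 0 a i else 0
  end.

Inductive prodkind := PKron | PKronD | PDKron.

Record factor := Factor {
  fkind : prodkind; fa : vform; va : seq R; fb : vform; vb : seq R }.

Definition factor_ok (F : factor) : bool :=
  match fkind F with
  | PKron => is_vec (fa F) && is_vec (fb F)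
  | PKronD => is_vec (fa F) && ~~ is_vec (fb F)
  | PDKron => ~~ is_vec (fa F) && is_vec (fb F)
  end.

(* Kronecker product of the two factor matrices: dimensions and entries *)
Definition fdims (F : factor) : nat * nat :=
  let d1 := vdims (fa F) (size (va F)) in
  let d2 := vdims (fb F) (size (vb F)) in
  ((d1.1 * d2.1)%N, (d1.2 * d2.2)%N).

Definition fentry (F : factor) (i j : nat) : R :=
  let d2 := vdims (fb F) (size (vb F)) in
  ventry (fa F) (va F) (i %/ d2.1) (j %/ d2.2) *
  ventry (fb F) (vb F) (i %% d2.1) (j %% d2.2).

Definition fdof (F : factor) : nat := (size (va F) + size (vb F))%N.

(* depth-2 LRNR of rank r: widths M_0 = 1, M_1 = width, M_2 = 1 *)
Record lrnr2 (r : nat) := LRNR2 {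
  width : nat;
  U1 : 'I_r -> factor;  (* layer-1 weight factors, shape width x 1 *)
  V1 : 'I_r -> factor;  (* layer-1 bias factors,   shape width x 1 *)
  U2 : 'I_r -> factor;  (* layer-2 weight factors, shape 1 x width *)
  V2 : 'I_r -> factor   (* layer-2 bias factors,   shape 1 x 1 *) }.

Definition lrnr2_wf r (N : lrnr2 r) : Prop :=
  forall i : 'I_r,
    [&& factor_ok (U1 N i), factor_ok (V1 N i), factor_ok (U2 N i) & factor_ok (V2 N i)] /\
    fdims (U1 N i) = (width N, 1%N) /\ fdims (V1 N i) = (width N, 1%N) /\
    fdims (U2 N i) = (1%N, width N) /\ fdims (V2 N i) = (1%N, 1%N).

Definition dof r (N : lrnr2 r) : nat :=
  (\sum_(i < r) (fdof (U1 N i) + fdof (V1 N i) + fdof (U2 N i) + fdof (V2 N i)))%N.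

Definition lrnr2_eval r (N : lrnr2 r) (g1 g2 t1 t2 : 'rV[R]_r) (x : R) : R :=
  \sum_(k < width N)
     (\sum_(i < r) g2 0 i * fentry (U2 N i) 0 k) *
     relu ((\sum_(i < r) g1 0 i * fentry (U1 N i) k 0) * x
           + \sum_(i < r) t1 0 i * fentry (V1 N i) k 0)
  + \sum_(i < r) t2 0 i * fentry (V2 N i) 0 0.

Definition affine2 n r (f : 'rV[R]_n -> 'rV[R]_n -> 'rV[R]_r) : Prop :=
  exists (Ma Mb : 'M[R]_(n, r)) (c : 'rV[R]_r),
    forall a b, f a b = a *m Ma + b *m Mb + c.

End LRNRDefs.

(* Main.v *)
(** For an increasing g, rho (g^-1 x - y) = rho (x - g y), so transporting a
    piecewise constant function moves its jumps y to g y, which is linear in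
    the coefficients of g; a two-neuron ramp with kinks depending affinely on
    g y replaces each jump.  The total variation controls the sizes of the jumps
    y with g y in Om only.  The ramps are therefore slightly rescaled so that
    they are exact on Om when g y lies outside Om, while for g y in Om the error
    is at most 1 on an interval of length eps / 16, and eps / 16 is a lower bound
    for the L^1 norm of rho - rho_eps. *)

Require Import Defs.
From HB Require Import structures.
From mathcomp Require Import all_boot all_order all_algebra.
From mathcomp Require Import all_classical all_reals all_analysis.
From mathcomp Require Import measurable_realfun zify ring lra.
Import Order.TTheory GRing.Theory Num.Theory.
Import numFieldNormedType.Exports.
Local Open Scope classical_set_scope.
Local Open Scope ring_scope.

Set Implicit Arguments.
Unset Strict Implicit.
Unset Printing Implicit Defensive.

(** * Ramps that replace a single jump *)

(** Rises from 0 to 1 on the interval from [(t - d1) / w] to [(t - d2) / w], when [0 < w] and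
    [d2 < d1]. The choice [w = 1], [d1 = eps / 2], [d2 = - eps / 2] gives [rho_eps eps (x - t)]. *)
Definition ramp (R : realType) (w d1 d2 t x : R) : R :=
  (relu (w * x + d1 - t) - relu (w * x + d2 - t)) / (d1 - d2).

Lemma relu_ge0E (R : realType) (x : R) : 0 <= x -> relu x = x.
Proof. by move=> x0; rewrite /relu max_r. Qed.

Lemma relu_le0E (R : realType) (x : R) : x <= 0 -> relu x = 0.
Proof. by move=> x0; rewrite /relu max_l. Qed.

Lemma ramp_eq1 (R : realType) (w d1 d2 t x : R) :
  d2 < d1 -> t <= w * x + d2 -> ramp w d1 d2 t x = 1.
Proof.
move=> d21 tx; rewrite /ramp !relu_ge0E; [|lra|lra].
by rewrite (_ : _ - _ = d1 - d2) ?divff//; [rewrite subr_eq0 gt_eqF|ring].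
Qed.

Lemma ramp_eq0 (R : realType) (w d1 d2 t x : R) :
  d2 < d1 -> w * x + d1 <= t -> ramp w d1 d2 t x = 0.
Proof. by move=> d21 tx; rewrite /ramp !relu_le0E ?subrr ?mul0r//; lra. Qed.

Lemma ramp_itv01 (R : realType) (w d1 d2 t x : R) :
  d2 < d1 -> 0 <= ramp w d1 d2 t x <= 1.
Proof.
move=> d21; rewrite /ramp ler_pdivlMr ?ler_pdivrMr ?subr_gt0// mul0r mul1r.
have [a0|a0] := leP 0 (w * x + d1 - t); have [b0|b0] := leP 0 (w * x + d2 - t).
- by rewrite !relu_ge0E//; lra.
- by rewrite relu_ge0E// relu_le0E//; lra.
- lra.
- by rewrite !relu_le0E//; lra.
Qed.

(** The condition on [(1 - w) * t] says that [t] itself lies in the transition interval. Outside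
    that interval ramp and step coincide; inside it both have values between 0 and 1. *)
Lemma ramp_error (R : realType) (w d1 d2 t x : R) :
  0 < w -> d2 < d1 -> d2 <= (1 - w) * t <= d1 ->
  `|rho (x - t) - ramp w d1 d2 t x|
    <= \1_`[(t - d1) / w, (t - d2) / w] x.
Proof.
move=> w0 d21 /andP[dt td]; rewrite indicE.
have [xin|] := boolP (x \in _).
  have /andP[r0 r1] := ramp_itv01 w t x d21.
  by rewrite /= /rho ler_norml; case: ifP => _; lra.
rewrite notin_setE/= in_itv/= => /negP; rewrite negb_and -!ltNge.
rewrite ltr_pdivlMr// ltr_pdivrMr// /rho => /orP[xt|xt].
- rewrite ramp_eq0//; last lra.
  by rewrite ifF ?subrr ?normr0//; apply/negbTE; rewrite -ltNge; nra.
- by rewrite ramp_eq1 ?ifT ?subrr ?normr0//; [nra|lra].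
Qed.

(* For bounded [Om], x |-> w x + d2 fixes inf Om and x |-> w x + d1 fixes
   sup Om, so a ramp for a jump outside [Om] has its transition outside [Om]. *)
Lemma ramp_window (R : realType) (Om : set R) (eta : R) :
  open Om -> is_interval Om -> 0 < eta ->
  exists w d1 d2 : R, [/\ 0 < w, d2 < d1, d1 - d2 <= w * eta,
    forall t, Om t -> d2 <= (1 - w) * t <= d1 &
    forall x t, Om x -> ~ Om t ->
      (t < x -> t <= w * x + d2) /\ (x < t -> w * x + d1 <= t)].
Proof.
move=> oOm iOm e0.
have [->|/set0P[z Omz]] := eqVneq Om set0.
  by exists 1, eta, 0; split => //; rewrite mul1r subr0.
have below x t : Om x -> ~ Om t -> t < x -> lbound Om t.
  move=> Omx Omt tx y Omy; rewrite leNgt; apply/negP => yt.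
  by apply: Omt; apply: (iOm y x) => //; rewrite !ltW.
have above x t : Om x -> ~ Om t -> x < t -> ubound Om t.
  move=> Omx Omt tx y Omy; rewrite leNgt; apply/negP => yt.
  by apply: Omt; apply: (iOm x y) => //; rewrite !ltW.
have [hu|hu] := pselect (has_ubound Om); last first.
  (* Without an upper bound, a point outside [Om] can only lie below it, so the transition is put on
     the left of the jump. *)
  exists 1, eta, 0; split => //; first by rewrite mul1r subr0.
    by move=> t _; rewrite subrr mul0r lexx ltW.
  move=> x t Omx Omt; split => xt; first by rewrite mul1r addr0 ltW.
  by case: hu; exists t; exact: (above x).
have [hl|hl] := pselect (has_lbound Om); last first.
  (* The mirror case: a point outside [Om] lies above it, and the transition is put on the right of
     the jump. *)
  exists 1, 0, (- eta); split => //; first by rewrite oppr_lt0.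
  - by rewrite mul1r sub0r opprK.
  - by move=> t _; rewrite subrr mul0r lexx oppr_le0 ltW.
  move=> x t Omx Omt; split => xt; last by rewrite mul1r addr0 ltW.
  by case: hl; exists t; exact: (below x).
have Om0 : Om !=set0 by exists z.
have ile x : Om x -> inf Om <= x by move=> ?; exact: ge_inf.
have les x : Om x -> x <= sup Om by move=> ?; exact: ub_le_sup.
have is_ : inf Om < sup Om.
  have [e /= e_gt0 he] : nbhs_ball z Om.
    by apply/nbhs_ballP; exact: open_nbhs_nbhs.
  have Omy : Om (z + e / 2).
    by apply: he; rewrite /ball /= opprD addNKr normrN gtr0_norm ?divr_gt0//; lra.
  by have := ile _ Omz; have := les _ Omy; lra.
set i := inf Om in ile is_ *; set s := sup Om in les is_ *.
have D0 : 0 < s - i + eta by lra.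
(* This [w] solves [(1 - w) * (s - i) = w * eta]: with [d1 = (1 - w) * s] and [d2 = (1 - w) * i],
   the transition interval has length exactly [eta]. *)
set w := (s - i) / (s - i + eta).
have w0 : 0 < w by rewrite divr_gt0// subr_gt0.
have w1 : (1 - w) * (s - i + eta) = eta by rewrite /w; field; rewrite gt_eqF.
have w1' : (1 - w) * (s - i) = w * eta by rewrite /w; field; rewrite gt_eqF.
have w10 : 0 < 1 - w by rewrite -(pmulr_lgt0 _ D0) w1.
exists w, ((1 - w) * s), ((1 - w) * i); split => //.
- by rewrite ltr_pM2l.
- by rewrite -mulrBr w1'.
- by move=> t Omt; rewrite !ler_pM2l// ile// les.
- move=> x t Omx Omt; split => xt.
  + have ti : t <= i by apply: lb_le_inf => //; exact: (below x).
    by have := ile _ Omx; nra.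
  + have ts : s <= t by apply: ge_sup => //; exact: (above x).
    by have := les _ Omx; nra.
Qed.

(** * Strict monotonicity of the admissible functions *)

(** Induction on the exceptional points: one that lies between [x] and [y] splits the interval in
    two, and an interval free of them is handled by the mean value theorem. *)
Lemma gt0_derive_lt (R : realType) (g : R -> R) (s : seq R) :
  continuous g ->
  (forall x, x \notin s -> derivable g x 1 /\ 0 < derive1 g x) ->
  {homo g : x y / x < y}.
Proof.
move=> cg dg x y xy.
(* Localizing the hypothesis to []x, y[] lets the induction drop an exceptional point that lies
   outside the subinterval at hand. *)
have {dg} : forall z, z \in `]x, y[ -> z \notin s -> derivable g z 1 /\ 0 < derive1 g z.
  by move=> z _; exact: dg.
elim: s x y xy => [|c s IH] x y xy dg.
  have dg' z : z \in `]x, y[ -> is_derive z 1 g (derive1 g z).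
    by move=> zxy; have [d _] := dg z zxy isT; rewrite derive1E; exact: derivableP.
  have [z zxy gz] := MVT xy dg' (continuous_subspaceT cg).
  by rewrite -subr_gt0 gz mulr_gt0 ?subr_gt0//; case: (dg z zxy isT).
have [|cxy] := boolP (c \in `]x, y[); last first.
  apply: IH => // z zxy zs; apply: dg => //; rewrite in_cons negb_or zs andbT.
  by apply: contraNneq cxy => <-.
rewrite in_itv/= => /andP[xc cy]; apply: (@lt_trans _ _ (g c)).
  apply: IH => // z; rewrite in_itv/= => /andP[xz zc] zs; apply: dg.
    by rewrite in_itv/= xz (lt_trans zc).
  by rewrite in_cons negb_or zs lt_eqF.
apply: IH => // z; rewrite in_itv/= => /andP[cz zy] zs; apply: dg.
  by rewrite in_itv/= zy (lt_trans xc).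
by rewrite in_cons negb_or zs gt_eqF.
Qed.

(** Off the finitely many breakpoints, some ball around [x] contains none of them, and [f] is affine
    on it. *)
Lemma pw_linear_derivable (R : realType) (f : R -> R) : pw_linear f ->
  exists s : seq R, forall x, x \notin s -> derivable f x 1.
Proof.
move=> [s hs]; exists s => x xs.
have [d d0 hd] : exists2 d : R, 0 < d & forall z, z \in s -> `|z - x| >= d.
  elim: s xs {hs} => [_|z s IH]; first by exists 1.
  rewrite in_cons negb_or => /andP[xz /IH[d d0 hd]].
  exists (Num.min d `|z - x|).
    by rewrite lt_min d0 normr_gt0 subr_eq0 eq_sym.
  move=> y; rewrite in_cons => /predU1P[->|/hd]; first by rewrite ge_min lexx orbT.
  by rewrite ge_min => ->.
have [|z zs [z1 z2]|a [b fab]] := hs (x - d) (x + d).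
- lra.
- have := hd _ zs; rewrite leNgt ltr_norml => /negP; apply.
  by apply/andP; split; lra.
apply: (@near_eq_derivable _ _ _ (fun t => a * t + b)).
  have xin : x \in `]x - d, x + d[ by rewrite in_itv/=; apply/andP; split; lra.
  have := near_in_itvoo xin; apply: filterS => t.
  by rewrite in_itv/= => /andP[t1 t2]; rewrite fab.
by apply: derivableD => //; apply: derivableM.
Qed.

Lemma lincomb_continuous (R : realType) n (phi : 'I_n -> R -> R) (a : 'rV[R]_n) :
  (forall i, continuous (phi i)) -> continuous (lincomb a phi).
Proof.
move=> cphi; apply: continuous_big => [|i _ x]; first exact: add_continuous.
by apply: cvgM; [exact: cvg_cst|exact: cphi].
Qed.

(** Admissibility bounds the derivative only where it exists; it exists off the pooled breakpoints
    of all [phi i], a finite list, and there it is at least [c > 0]. *)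
Lemma admissible_lt (R : realType) n (phi : 'I_n -> R -> R) A (Om : set R) a :
  (forall i, P1C (phi i)) -> admissible phi A Om -> A a ->
  {homo lincomb a phi : x y / x < y}.
Proof.
move=> hphi [c [C [c0 [_ hA]]]] Aa.
have [dA _] := hA a Aa.
have /choice[s hs] : forall i, exists s : seq R, forall x, x \notin s -> derivable (phi i) x 1.
  by move=> i; apply: pw_linear_derivable; case: (hphi i).
apply: (@gt0_derive_lt _ _ (flatten [seq s i | i <- enum 'I_n])).
  by apply: lincomb_continuous => i; case: (hphi i).
move=> x xs.
have d : derivable (lincomb a phi) x 1.
  rewrite (_ : lincomb a phi = \sum_(i < n) (a 0 i \*: phi i)); last first.
    by apply/funext => y; rewrite /lincomb fct_sumE.
  apply: derivable_sum => i; apply: derivableZ; apply: hs.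
  apply: contra xs => xs; apply/flatten_mapP; exists i => //.
  by rewrite mem_enum.
by split => //; case/andP: (dA _ d) => cl _; exact: lt_le_trans cl.
Qed.

(** * Jump heights and total variation *)

(** A position may occur several times in [s], with heights that cancel; the variation sees only
    their sum. *)
Definition jump (R : realType) (s : seq (R * R)) (y : R) : R :=
  \sum_(p <- s | p.2 == y) p.1.

Lemma sum_jump (R : realType) (s : seq (R * R)) (G : R -> R) :
  \sum_(p <- s) p.1 * G p.2
  = \sum_(y <- undup [seq p.2 | p <- s]) jump s y * G y.
Proof.
under [RHS]eq_bigr do rewrite /jump mulr_suml big_mkcond /=.
rewrite exchange_big/=; apply: eq_big_seq => p ps.
rewrite (bigD1_seq p.2) ?undup_uniq//=; last first.
  by rewrite mem_undup; apply: map_f.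
by rewrite eqxx big1 ?addr0// => y; rewrite eq_sym => /negbTE->.
Qed.

(** No position lies strictly between [z] and [y], and since [rho 0 = 1] the value at [y] already
    includes the jump there. *)
Lemma psi_of_jump (R : realType) (s : seq (R * R)) (z y : R) : z < y ->
  (forall p, p \in s -> p.2 < y -> p.2 <= z) ->
  psi_of s y - psi_of s z = jump s y.
Proof.
move=> zy hs; rewrite /psi_of -sumrB /jump [RHS]big_mkcond/=.
apply: eq_big_seq => p /hs {}hs; rewrite /rho !subr_ge0.
have [py|py|->] := ltgtP p.2 y.
- by rewrite hs// subrr.
- by rewrite leNgt (lt_trans zy py)/= subrr.
- by rewrite leNgt zy/= mulr1 mulr0 subr0.
Qed.

Lemma gap_before (R : realType) (s : seq (R * R)) (x y : R) : x < y ->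
  exists z, [/\ x < z, z < y & forall p, p \in s -> p.2 < y -> p.2 <= z].
Proof.
move=> xy; elim: s => [|q s [z [xz zy hz]]].
  by exists ((x + y) / 2); split => //; lra.
have [qy|qy] := ltP q.2 y.
  exists (Num.max q.2 z); split => [||p].
  - by rewrite lt_max xz orbT.
  - by rewrite gt_max qy.
  - by rewrite in_cons le_max => /predU1P[->|/hz h /h ->]; rewrite ?lexx ?orbT.
exists z; split => // p; rewrite in_cons => /predU1P[->|/hz//].
by rewrite ltNge qy.
Qed.

Lemma TV_ge0 (R : realType) (U : set R) (f : R -> R) : (0 <= TV U f)%E.
Proof.
apply: ereal_sup_ubound; exists [::]; last by rewrite /= big_ord0.
by split.
Qed.

Lemma le_TV (R : realType) (U I : set R) (f : R -> R) z t :
  is_interval I -> I `<=` U -> path <%R z t -> {in z :: t, forall x, I x} ->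
  ((\sum_(k < size t) `|f (nth 0 t k) - f (nth 0 (z :: t) k)|)%:E <= TV U f)%E.
Proof.
move=> iI IU zt It; apply: ereal_sup_ubound; exists (z :: t) => //; split => //.
move=> k kt x xk; apply: IU.
apply: (iI (nth 0 (z :: t) k) (nth 0 (z :: t) k.+1)) => //.
  by apply/It/mem_nth/ltnW.
by apply/It/mem_nth.
Qed.

(** Just before each [y] a point is inserted with no position of [s] strictly in between, so the
    increment from it to [y] is the full jump; the other increments only add to the variation. *)
Lemma jumps_le_var (R : realType) (I : set R) (s : seq (R * R)) ys z :
  is_interval I -> path <%R z ys -> {in z :: ys, forall x, I x} ->
  exists t, [/\ path <%R z t, {in z :: t, forall x, I x} &
    \sum_(y <- ys) `|jump s y| <=
    \sum_(k < size t) `|psi_of s (nth 0 t k) - psi_of s (nth 0 (z :: t) k)|].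
Proof.
move=> iI; elim: ys z => [|y ys IH] z.
  by move=> _ Iz; exists [::]; split => //; rewrite big_nil big_ord0.
move=> /= /andP[zy yys] Iz.
have [//|x xs|t [yt It le_t]] := IH y; first by apply: Iz; rewrite in_cons xs orbT.
have [x [zx xy hx]] := gap_before s zy.
exists (x :: y :: t); split.
- by rewrite /= zx xy.
- move=> u; rewrite !in_cons => /or3P[/eqP->|/eqP->|ut].
  + by apply: Iz; rewrite mem_head.
  + apply: (iI z y); rewrite ?ltW//; apply: Iz; rewrite !in_cons eqxx ?orbT//.
  + by apply: It; rewrite in_cons.
rewrite big_cons/= big_ord_recl/= big_ord_recl/= addrA lerD//.
by rewrite (psi_of_jump xy hx) lerDr.
Qed.

Lemma jumps_le_TV (R : realType) (U I : set R) (s : seq (R * R)) :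
  open I -> is_interval I -> I `<=` U ->
  ((\sum_(y <- undup [seq p.2 | p <- s] | y \in I) `|jump s y|)%:E
    <= TV U (psi_of s))%E.
Proof.
move=> oI iI IU; rewrite -big_filter.
set ys0 := seq.filter _ _.
have ys0u : uniq ys0 by rewrite filter_uniq ?undup_uniq.
rewrite -(perm_big _ (permEl (perm_sort <=%R ys0))) /=.
set ys := sort _ _.
have Iys x : x \in ys -> I x.
  by rewrite mem_sort mem_filter => /andP[/set_mem].
have : sorted <%R ys by rewrite sort_lt_sorted.
case: ys Iys => [|y ys] Iys; first by rewrite big_nil TV_ge0.
move=> /= yys.
(* Openness supplies a point of [I] to the left of the first jump, from which that jump is seen. *)
have [e /= e_gt0 he] : nbhs_ball y I.
  by apply/nbhs_ballP; apply: open_nbhs_nbhs; split => //; apply: Iys; rewrite mem_head.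
have Iz : I (y - e / 2).
  by apply: he; rewrite /ball /= opprB addrC subrK gtr0_norm ?divr_gt0//; lra.
have [||t [zt It le_t]] := @jumps_le_var _ I s (y :: ys) (y - e / 2) iI.
- by rewrite /= yys andbT; lra.
- by move=> x; rewrite in_cons => /predU1P[->//|/Iys].
by apply: le_trans (le_TV _ iI IU zt It); rewrite lee_fin.
Qed.

(** * Measurability and integral estimates *)

Lemma measurable_relu (R : realType) (D : set R) (f : R -> R) :
  measurable_fun D f -> measurable_fun D (fun x => relu (f x)).
Proof. by move=> mf; apply: measurable_maxr. Qed.

Lemma measurable_rho (R : realType) (D : set R) (f : R -> R) :
  measurable D -> measurable_fun D f -> measurable_fun D (fun x => rho (f x)).
Proof.
move=> mD mf; apply: measurable_fun_if => //.
exact: measurable_fun_ler.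
Qed.

Lemma measurable_ramp (R : realType) (D : set R) (w d1 d2 t : R) :
  measurable D -> measurable_fun D (ramp w d1 d2 t).
Proof.
move=> mD; apply: measurable_funM => //.
by apply: measurable_funB; apply: measurable_relu;
  apply: measurable_funB => //; apply: measurable_funD => //;
  apply: measurable_funM.
Qed.

(** On [[0, eps / 4]] the step is 1 and [rho_eps] is at most 3/4, so the error is at least 1/4
    there. The exact norm is [eps / 4], but this crude bound suffices. *)
Lemma rho_eps_error_ge (R : realType) (eps : R) : 0 < eps ->
  ((eps / 16)%:E <=
   \int[lebesgue_measure]_(x in [set: R]) (`|rho x - rho_eps eps x|)%:E)%E.
Proof.
move=> e0.
apply: (@le_trans _ _ (\int[lebesgue_measure]_(x in [set: R])
    (1 / 4 * \1_`[0, eps / 4] x)%:E)%E).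
  under eq_integral do rewrite EFinM.
  rewrite ge0_integralZl_EFin//; last first.
    by apply/measurable_EFinP; exact: measurable_indic.
  rewrite integral_indic// setIT.
  rewrite /= lebesgue_measure_itv/= lte_fin divr_gt0//.
  by rewrite oppr0 adde0 -EFinM lee_fin; lra.
apply: ge0_le_integral => //.
- apply/measurable_EFinP; apply: measurable_funM => //; exact: measurable_indic.
- apply/measurable_EFinP; apply: measurableT_comp => //.
  apply: measurable_funB; first exact: measurable_rho.
  apply: measurable_funM => //; apply: measurable_funB; apply: measurable_relu.
    exact: measurable_funD.
  exact: measurable_funB.
- move=> x _; rewrite lee_fin indicE.
  have [|] := boolP (x \in _); last by rewrite mulr0.
  rewrite inE/= in_itv/= => /andP[x0 xe]; rewrite mulr1.
  rewrite /rho x0 /rho_eps (relu_ge0E (_ : 0 <= x + eps / 2)); last lra.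
  rewrite (relu_le0E (_ : x - eps / 2 <= 0)); last lra.
  have : eps^-1 * (x + eps / 2 - 0) <= 3 / 4.
    by rewrite mulrC ler_pdivrMr//; lra.
  by move=> h; rewrite ger0_norm; lra.
Qed.

Lemma integral_steps_le (R : realType) (J : Type) (s : seq J) (c l u : J -> R)
    (D : set R) (eta : R) :
  measurable D -> (forall j, 0 <= c j) -> 0 <= eta ->
  (forall j, u j - l j <= eta) ->
  (\int[lebesgue_measure]_(x in D) (\sum_(j <- s) c j * \1_`[l j, u j] x)%:E
   <= ((\sum_(j <- s) c j) * eta)%:E)%E.
Proof.
move=> mD c0 e0 lu.
under eq_integral do rewrite -sumEFin.
rewrite ge0_integral_sum//; last 2 first.
- by move=> j; apply/measurable_EFinP; apply: measurable_funM => //; exact: measurable_indic.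
- by move=> j x _; rewrite lee_fin mulr_ge0// indicE.
rewrite mulr_suml -sumEFin; apply: lee_sum => j _.
under eq_integral do rewrite EFinM.
rewrite ge0_integralZl_EFin//; last first.
  by apply/measurable_EFinP; exact: measurable_indic.
rewrite EFinM lee_wpmul2l ?lee_fin// integral_indic//.
apply: (@le_trans _ _ (lebesgue_measure `[l j, u j])).
  by apply: le_measure; rewrite ?inE//; exact: measurableI.
(* If [u j <= l j], the interval has measure 0, and [0 <= eta] is used. *)
rewrite lebesgue_measure_itv/= lte_fin; case: ifP => _; last by rewrite lee_fin.
by rewrite -EFinB lee_fin.
Qed.

(** * The error of the ramp approximation *)

Lemma hbar_open (R : realType) n (phi : 'I_n -> R -> R) ps (a b : 'rV[R]_n)
    (Om : set R) x :
  {homo lincomb a phi : x y / x < y} -> Om `<=` range (lincomb a phi) -> Om x ->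
  hbar phi ps a b x =
  \sum_(i < n) b 0 i * \sum_(p <- ps i) p.1 * rho (x - lincomb a phi p.2).
Proof.
move=> gmono sg /sg[t _ gt]; rewrite /hbar /lincomb.
apply: eq_bigr => i _; congr (_ * _); apply: eq_bigr => p _; congr (_ * _).
rewrite -/(lincomb a phi).
(* As [x] is in the range, [xget] returns a true preimage and not its default 0. *)
have gx : lincomb a phi (ginv (lincomb a phi) x) = x.
  by rewrite /ginv; case: xgetP => [y _ //|/(_ t)].
by rewrite /rho !subr_ge0 -[in RHS]gx (le_mono gmono).
Qed.

Lemma normr_le_supnorm (R : realType) n (b : 'rV[R]_n) i : `|b 0 i| <= supnorm b.
Proof. exact: le_bigmax. Qed.

Lemma supnorm_ge0 (R : realType) n (b : 'rV[R]_n) : 0 <= supnorm b.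
Proof. by rewrite /supnorm; elim/big_ind: _ => // x y x0 y0; rewrite le_max x0. Qed.

(** Only jumps at [y] with [g y] in [Om] cause an error on [Om]. These [y] fill an open interval
    inside [Om_hat], so the total variation there bounds the sum of their heights. *)
Lemma hbar_ramp_error (R : realType) n (phi : 'I_n -> R -> R) ps
    (A : set 'rV[R]_n) (a b : 'rV[R]_n) (Om : set R) (w d1 d2 eta : R) :
  open Om -> is_interval Om -> (forall i, continuous (phi i)) ->
  {homo lincomb a phi : x y / x < y} -> Om `<=` range (lincomb a phi) -> A a ->
  0 < w -> d2 < d1 -> d1 - d2 <= w * eta ->
  (forall t, Om t -> d2 <= (1 - w) * t <= d1) ->
  (forall x t, Om x -> ~ Om t ->
    (t < x -> t <= w * x + d2) /\ (x < t -> w * x + d1 <= t)) ->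
  (\int[lebesgue_measure]_(x in Om) (`|hbar phi ps a b x -
      \sum_(i < n) b 0 i *
        \sum_(p <- ps i) p.1 * ramp w d1 d2 (lincomb a phi p.2) x|)%:E
   <= (\sum_(i < n) TV (Om_hat phi A Om) (psi_of (ps i)))
      * (supnorm b)%:E * eta%:E)%E.
Proof.
move=> oOm iOm cphi gmono sg Aa w0 d21 dw Omin Omout.
set g := lincomb a phi.
have mOm : measurable Om by exact: open_measurable.
have e0 : 0 < eta by rewrite -(pmulr_rgt0 _ w0); apply: lt_le_trans dw; rewrite subr_gt0.
(* The pairs of a function index and a distinct jump position that is transported into [Om]. *)
pose S := [seq (i, y) | i <- enum 'I_n,
  y <- [seq y <- undup [seq p.2 | p <- ps i] | y \in g @^-1` Om]].
pose c (q : 'I_n * R) := `|b 0 q.1| * `|jump (ps q.1) q.2|.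
pose l (q : 'I_n * R) := (g q.2 - d1) / w.
pose u (q : 'I_n * R) := (g q.2 - d2) / w.
have sumS (F : 'I_n * R -> R) : \sum_(q <- S) F q =
    \sum_(i < n) \sum_(y <- undup [seq p.2 | p <- ps i] | y \in g @^-1` Om) F (i, y).
  by rewrite big_allpairs_dep big_enum/=; apply: eq_bigr => i _; rewrite big_filter.
have iI : is_interval (g @^-1` Om).
  move=> x y Ox Oy z /andP[xz zy]; apply: (iOm _ _ Ox Oy).
  by rewrite !(le_mono gmono) xz zy.
have oI : open (g @^-1` Om).
  by apply: open_comp => // x _; exact: lincomb_continuous.
have IU : g @^-1` Om `<=` Om_hat phi A Om by move=> x gx; exists a.
pose E x := \sum_(i < n) b 0 i *
  \sum_(p <- ps i) p.1 * (rho (x - g p.2) - ramp w d1 d2 (g p.2) x).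
rewrite [leLHS](_ : _ = \int[lebesgue_measure]_(x in Om) (`|E x|)%:E)%E; last first.
  apply: eq_integral => x /set_mem Omx; rewrite (hbar_open _ _ gmono sg)// -sumrB.
  congr (`| _ |%:E); apply: eq_bigr => i _; rewrite -mulrBr -sumrB; congr (_ * _).
  by apply: eq_bigr => p _; rewrite mulrBr.
have Ele x : Om x -> `|E x| <= \sum_(q <- S) c q * \1_`[l q, u q] x.
  move=> Omx; rewrite sumS /E; apply: (le_trans (ler_norm_sum _ _ _)).
  apply: ler_sum => i _; rewrite normrM.
  rewrite (sum_jump _ (fun y => rho (x - g y) - ramp w d1 d2 (g y) x)).
  under [leRHS]eq_bigr do rewrite /c -mulrA /=.
  rewrite -mulr_sumr ler_wpM2l//.
  apply: (le_trans (ler_norm_sum _ _ _)).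
  rewrite [leRHS]big_mkcond/=; apply: ler_sum => y _; rewrite normrM.
  have [/set_mem gy|/negP gy] := boolP (y \in _).
    by rewrite ler_wpM2l//; apply: ramp_error => //; exact: Omin.
  have gy' : ~ Om (g y) by move=> h; apply: gy; exact: mem_set.
  have [h1 h2] := Omout x (g y) Omx gy'.
  (* A jump transported outside [Om]: here [x = g y] is impossible because [x] lies in [Om], and on
     either side the ramp equals the step. *)
  rewrite /rho subr_ge0; have [gx|xg] := ltP (g y) x.
    by rewrite (ltW gx)/= ramp_eq1 ?subrr ?normr0 ?mulr0//; exact: h1.
  have {}xg : x < g y.
    by rewrite lt_neqAle xg andbT; apply/eqP => xgy; apply: gy'; rewrite -xgy.
  by rewrite (leNgt (g y)) xg/= ramp_eq0 ?subrr ?normr0 ?mulr0//; exact: h2.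
apply: (@le_trans _ _ (\int[lebesgue_measure]_(x in Om)
    (\sum_(q <- S) c q * \1_`[l q, u q] x)%:E)%E).
  apply: ge0_le_integral => //.
  - apply/measurable_EFinP; apply: measurableT_comp => //.
    apply: measurable_sum => i; apply: measurable_funM => //.
    apply: measurable_sum => p; apply: measurable_funM => //.
    apply: measurable_funB; last exact: measurable_ramp.
    by apply: measurable_rho => //; exact: measurable_funB.
  - apply/measurable_EFinP; apply: measurable_sum => q.
    by apply: measurable_funM => //; exact: measurable_indic.
apply: (@le_trans _ _ ((\sum_(q <- S) c q) * eta)%:E).
  apply: integral_steps_le => //; last 1 first.
  - move=> q; rewrite /u /l -mulrBl ler_pdivrMr// (mulrC eta).
    by apply: le_trans dw; lra.
  - by move=> q; rewrite mulr_ge0.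
  - exact: ltW.
rewrite EFinM lee_wpmul2r ?lee_fin ?(ltW e0)//.
rewrite sumS.
apply: (@le_trans _ _ (((\sum_(i < n) \sum_(y <- undup [seq p.2 | p <- ps i]
    | y \in g @^-1` Om) `|jump (ps i) y|) * supnorm b)%:E)).
  rewrite lee_fin mulr_suml; apply: ler_sum => i _; rewrite mulr_suml.
  by apply: ler_sum => y _; rewrite /c/= mulrC ler_wpM2l// normr_le_supnorm.
rewrite EFinM lee_wpmul2r ?lee_fin ?supnorm_ge0// -sumEFin.
by apply: lee_sum => i _; apply: jumps_le_TV.
Qed.

(** * The network that realizes the ramps *)

(** The Kronecker product with the 1 x 1 vector [[:: 1]] makes any column one of the allowed
    products, at the cost of one extra parameter. *)
Definition col_factor (R : realType) (v : seq R) : Defs.factor R :=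
  Factor PKron VCol v VCol [:: 1].

Definition row_factor (R : realType) (v : seq R) : Defs.factor R :=
  Factor PKron VRow v VRow [:: 1].

Lemma fentry_col (R : realType) (v : seq R) k :
  fentry (col_factor v) k 0 = nth 0 v k.
Proof. by rewrite /fentry/= !divn1 !modn1/= mulr1. Qed.

Lemma fentry_row (R : realType) (v : seq R) k :
  fentry (row_factor v) 0 k = nth 0 v k.
Proof. by rewrite /fentry/= !divn1 !modn1/= mulr1. Qed.

(** Embeds the coefficients of rank [n] into those of rank [n.+1], leaving coordinate 0 free for
    constants. *)
Definition lift_mx (R : realType) n : 'M[R]_(n, n.+1) :=
  \matrix_(i, j) (j == lift ord0 i)%:R.

Lemma sum_lift_mx (R : realType) n (a : 'rV[R]_n) (F : 'I_n.+1 -> R) :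
  \sum_(j < n.+1) (a *m lift_mx R n) 0 j * F j
  = \sum_(i < n) a 0 i * F (lift ord0 i).
Proof.
rewrite big_ord_recl mxE big1 ?mul0r ?add0r => [|k _]; last first.
  by rewrite mxE (negbTE (neq_lift _ _)) mulr0.
apply: eq_bigr => i _; congr (_ * _); rewrite mxE (bigD1 i)//= mxE eqxx mulr1.
rewrite big1 ?addr0// => k ki; rewrite mxE (inj_eq lift_inj) eq_sym.
by rewrite (negbTE ki) mulr0.
Qed.

Lemma sum_delta_mx (R : realType) n (F : 'I_n.+1 -> R) :
  \sum_(j < n.+1) (delta_mx 0 ord0 : 'rV[R]_n.+1) 0 j * F j = F ord0.
Proof.
rewrite big_ord_recl mxE eqxx mul1r big1 ?addr0// => i _.
by rewrite mxE /= mul0r.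
Qed.

(* Each jump of each [psi_i] gets two neurons, one for each kink of its ramp. *)
Definition neurons (R : realType) n (ps : 'I_n -> seq (R * R)) :
    seq ('I_n * (R * R) * bool) :=
  [seq (q, true) | q <- [seq (i, p) | i <- enum 'I_n, p <- ps i]] ++
  [seq (q, false) | q <- [seq (i, p) | i <- enum 'I_n, p <- ps i]].

Lemma sum_neurons (R : realType) n (ps : 'I_n -> seq (R * R)) F :
  \sum_(q <- neurons ps) F q
  = \sum_(i < n) \sum_(p <- ps i) (F (i, p, true) + F (i, p, false)) :> R.
Proof.
rewrite big_cat/= !big_map !big_allpairs_dep !big_enum/= -big_split.
by apply: eq_bigr => i _; rewrite -big_split.
Qed.

Lemma size_neurons (R : realType) n (ps : 'I_n -> seq (R * R)) :
  size (neurons ps) = (2 * \sum_(i < n) size (ps i))%N.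
Proof.
rewrite size_cat !size_map size_allpairs_dep addnn mul2n.
by rewrite sumnE big_map big_enum.
Qed.

(** Index 0 carries the constant shifts [d1] and [d2] of the first bias; index [lift ord0 i] carries
    [- phi i] at the jump positions, so that the bias becomes [d1 - g y] or [d2 - g y]. In the
    second layer it carries the signed heights of [psi_i], divided by [d1 - d2]. *)
Definition ramp_net (R : realType) n (phi : 'I_n -> R -> R)
    (ps : 'I_n -> seq (R * R)) (w d1 d2 : R) : lrnr2 R n.+1 :=
  LRNR2 (size (neurons ps))
    (fun=> col_factor [seq w | _ <- neurons ps])
    (fun j => col_factor [seq
      if unlift ord0 j is Some i then - phi i q.1.2.2
      else if q.2 then d1 else d2 | q : 'I_n * (R * R) * bool <- neurons ps])
    (fun j => row_factor [seq
      if unlift ord0 j is Some i then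
        if q.1.1 == i then (-1) ^+ (~~ q.2) * q.1.2.1 / (d1 - d2) else 0
      else 0 | q : 'I_n * (R * R) * bool <- neurons ps])
    (fun=> row_factor [:: 0]).

Lemma ramp_net_wf (R : realType) n (phi : 'I_n -> R -> R) ps w d1 d2 :
  lrnr2_wf (ramp_net phi ps w d1 d2).
Proof. by move=> i; rewrite /fdims /= !size_map !muln1. Qed.

(** Per index there are three vectors as long as the width; the 5 counts the four trailing entries
    [[:: 1]] and the output bias. *)
Lemma ramp_net_dof (R : realType) n (phi : 'I_n -> R -> R) ps w d1 d2 :
  dof (ramp_net phi ps w d1 d2) = (n.+1 * (3 * size (neurons ps) + 5))%N.
Proof.
rewrite /dof -[X in (X * _)%N]card_ord -sum_nat_const; apply: eq_bigr => i _.
by rewrite /fdof /= !size_map; lia.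
Qed.

Lemma ramp_net_eval (R : realType) n (phi : 'I_n -> R -> R) ps w d1 d2
    (a b : 'rV[R]_n) x :
  lrnr2_eval (ramp_net phi ps w d1 d2) (delta_mx 0 ord0) (b *m lift_mx R n)
    (a *m lift_mx R n + delta_mx 0 ord0) 0 x =
  \sum_(i < n) b 0 i *
    \sum_(p <- ps i) p.1 * ramp w d1 d2 (lincomb a phi p.2) x.
Proof.
rewrite /lrnr2_eval [X in _ + X]big1 ?addr0 => [|i _]; last by rewrite mxE mul0r.
pose F (q : 'I_n * (R * R) * bool) :=
  b 0 q.1.1 * ((-1) ^+ (~~ q.2) * q.1.2.1 / (d1 - d2)) *
  relu (w * x + ((if q.2 then d1 else d2) - lincomb a phi q.1.2.2)).
(* The output is first written as a sum over neurons; the two neurons of each jump are then paired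
   into its ramp. *)
transitivity (\sum_(q <- neurons ps) F q).
  rewrite [RHS]big_tnth /=; apply: eq_bigr => k _.
  set q := tnth _ k.
  have nthE (f : 'I_n * (R * R) * bool -> R) : nth 0 (map f (neurons ps)) k = f q.
    by rewrite (nth_map q)//; congr f; rewrite [RHS](tnth_nth q).
  rewrite /F sum_delta_mx sum_lift_mx fentry_col nthE; congr (_ * relu (_ + _)).
    under eq_bigr do rewrite fentry_row nthE liftK.
    rewrite (bigD1 q.1.1)//= eqxx big1 ?addr0// => i iq.
    by rewrite eq_sym (negbTE iq) mulr0.
  under eq_bigr do rewrite mxE mulrDl.
  rewrite big_split/= sum_delta_mx sum_lift_mx fentry_col nthE unlift_none.
  rewrite addrC /lincomb -sumrN; congr (_ + _); apply: eq_bigr => i _.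
  by rewrite fentry_col nthE liftK mulrN.
rewrite sum_neurons; apply: eq_bigr => i _; rewrite mulr_sumr.
apply: eq_bigr => p _; rewrite /F /ramp /= !addrA; ring.
Qed.

(** A [psi_i] without jumps would be zero. Having at least one jump lets the additive constant in
    [dof] be absorbed into a multiple of the jump count. *)
Lemma lin_indep_size_gt0 (R : realType) n (ps : 'I_n -> seq (R * R)) i :
  lin_indep (fun j => psi_of (ps j)) -> (0 < size (ps i))%N.
Proof.
move=> ind; rewrite lt0n size_eq0; apply/eqP => psi0.
have /rowP/(_ i) : delta_mx 0 i = 0 :> 'rV[R]_n.
  apply: ind => x; rewrite /lincomb big1// => j _; rewrite mxE eqxx /=.
  by case: eqP => [->|]; rewrite ?mul0r// psi0 /psi_of big_nil mulr0.
by rewrite !mxE !eqxx => /eqP; rewrite oner_eq0.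
Qed.

Unset Implicit Arguments.

(* n = r - 1 functions in Phi and Psi; the LRNR has rank r = n.+1 *)
Theorem theorem4p5 (R : realType) (n : nat) : (0 < n)%N ->
  exists C1 c2 C2 : R, 0 < C1 /\ 0 < c2 /\ 0 < C2 /\
  forall (Om : set R) (phi : 'I_n -> R -> R) (ps : 'I_n -> seq (R * R))
         (A B : set 'rV[R]_n) (eps : R),
    open Om -> is_interval Om ->
    (forall i, P1C (phi i)) -> lin_indep phi ->
    lin_indep (fun i => psi_of (ps i)) ->
    admissible phi A Om -> coef_bounded B -> 0 < eps ->
    exists N : lrnr2 R n.+1,
      lrnr2_wf N /\
      (dof N)%:R <= C1 * (\sum_(i < n) size (ps i))%:R /\
      c2 * (dof N)%:R <= (width N)%:R <= C2 * (dof N)%:R /\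
      exists (Cs Ds : set ('rV[R]_n.+1 * 'rV[R]_n.+1))
             (g1 g2 t1 t2 : 'rV[R]_n -> 'rV[R]_n -> 'rV[R]_n.+1),
        affine2 g1 /\ affine2 g2 /\ affine2 t1 /\ affine2 t2 /\
        (forall a b, A a -> B b -> Cs (g1 a b, g2 a b) /\ Ds (t1 a b, t2 a b)) /\
        forall a b, A a -> B b ->
          (\int[lebesgue_measure]_(x in Om)
              (`|hbar phi ps a b x - lrnr2_eval N (g1 a b) (g2 a b) (t1 a b) (t2 a b) x|)%:E
           <= (\sum_(i < n) TV (Om_hat phi A Om) (psi_of (ps i)))
              * ereal_sup [set (supnorm b')%:E | b' in B]
              * \int[lebesgue_measure]_(x in [set: R]) (`|rho x - rho_eps eps x|)%:E)%E.
Proof.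
(* With [S >= 1] jumps in all, [dof] is [n.+1 * (6 * S + 5)], at most [12 * n.+1 * S], while the
   width is [2 * S]. *)
move=> n_gt0; exists (12 * n.+1)%:R, (6 * n.+1)%:R^-1, 1.
rewrite ltr0n invr_gt0 ltr0n ltr01; do 3! split => //.
move=> Om phi ps A B eps oOm iOm hphi _ psi_ind hA _ eps0.
have eta0 : 0 < eps / 16 by rewrite divr_gt0.
have [w [d1 [d2 [w0 d21 dw Omin Omout]]]] := ramp_window oOm iOm eta0.
pose N := ramp_net phi ps w d1 d2.
have widthE : width N = (2 * \sum_(i < n) size (ps i))%N by exact: size_neurons.
have dofE : dof N = (n.+1 * (6 * \sum_(i < n) size (ps i) + 5))%N.
  by rewrite ramp_net_dof size_neurons mulnA.
have jumps_gt0 : (0 < \sum_(i < n) size (ps i))%N.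
  by rewrite (bigD1 (Ordinal n_gt0))//= addn_gt0 lin_indep_size_gt0.
have dof_le : (dof N <= 12 * n.+1 * \sum_(i < n) size (ps i))%N.
  by rewrite dofE (mulnC 12) -mulnA leq_mul2l; lia.
exists N; split; first exact: ramp_net_wf.
split; first by rewrite -natrM ler_nat.
split.
  rewrite mul1r ler_nat ler_pdivrMl ?ltr0n// -natrM ler_nat widthE.
  by apply/andP; split; [apply: (leq_trans dof_le); lia|rewrite dofE mulSn; lia].
(* The vector [a] enters only the first bias and [b] only the second weight; [delta_mx 0 ord0]
   switches on the constants stored at index 0. *)
exists setT, setT, (fun _ _ => delta_mx 0 ord0), (fun _ b => b *m lift_mx R n),
  (fun a _ => a *m lift_mx R n + delta_mx 0 ord0), (fun _ _ => 0).
split; first by exists 0, 0, (delta_mx 0 ord0) => a b; rewrite !mulmx0 !add0r.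
split; first by exists 0, (lift_mx R n), 0 => a b; rewrite mulmx0 add0r addr0.
split; first by exists (lift_mx R n), 0, (delta_mx 0 ord0) => a b; rewrite mulmx0 addr0.
split; first by exists 0, 0, 0 => a b; rewrite !mulmx0 !addr0.
split=> // a b Aa Bb.
have gmono := admissible_lt hphi hA Aa.
have sg : Om `<=` range (lincomb a phi).
  by case: hA => [c [C [_ [_ /(_ a Aa)[]]]]].
have cphi i : continuous (phi i) by case: (hphi i).
under eq_integral do rewrite ramp_net_eval.
apply: (le_trans (hbar_ramp_error _ _ oOm iOm cphi gmono sg Aa w0 d21 dw Omin Omout)).
have TV0 : (0 <= \sum_(i < n) TV (Om_hat phi A Om) (psi_of (ps i)))%E.
  by apply: sume_ge0 => i _; exact: TV_ge0.
apply: lee_pmul; rewrite ?lee_fin ?(ltW eta0)//.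
- by rewrite mule_ge0// lee_fin supnorm_ge0.
- by apply: lee_wpmul2l => //; apply: ereal_sup_ubound; exists b.
- exact: rho_eps_error_ge.
Qed.
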